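(* Let $\ell\geq 2$ and $m\geq 1$ be integers. For $1\le k\le \ell$ let $$g_k^{(m)}(t)=g(t)^{\underline{m-1}}\prod_{1\leq i<k}(t-x_i+1)\prod_{k<i\leq\ell}(t-x_i-m+1),\qquad g(t)=(t-x_1)(t-x_2)\cdots(t-x_\ell),$$ and $$\tau_k^m=\sum_{i=1}^\ell\Bigl(\sum_{j=1}^\ell \Sigma_{x_i}^{x_j}\,g_k^{(m)}(t)\,\Delta t\Bigr)\partial_i ,$$ where $\Sigma_a^b\,\cdot\,\Delta t$ denotes definite summation and $g(t)^{\underline{m-1}}$ is the falling power, and let $\widetilde{\tau}_k^m$ be the homogenization of $\tau_k^m$ with respect to the additional variable $z$. Let $\theta_0=\partial_1+\cdots+\partial_\ell$ and $\theta_E=z\partial_z+x_1\partial_1+\cdots+x_\ell\partial_\ell$. Then the $\ell+1$ vector fields $$\widetilde{\tau}_1^m-\widetilde{\tau}_2^m,\ \widetilde{\tau}_2^m-\widetilde{\tau}_3^m,\ \dots,\ \widetilde{\tau}_{\ell-1}^m-\widetilde{\tau}_\ell^m,\ \theta_0,\ \theta_E$$ form a basis, as a module over $\mathbb{C}[x_1,\dots,x_\ell,z]$, of the module $D(c\mathrm{Shi}_\ell(m))$ of logarithmic derivations of the cone $c\mathrm{Shi}_\ell(m)$ over the $m$-Shi arrangement of type $A_{\ell-1}$.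
   Context: Logarithmic derivations: let $R=\mathbb{C}[x_1,\dots,x_\ell,z]$, and let $\mathrm{Der}_R=\bigoplus_{i=1}^{\ell}R\,\partial_i\oplus R\,\partial_z$ be the module of $\mathbb{C}$-linear derivations of $R$, with $\partial_i=\partial/\partial x_i$, $\partial_z=\partial/\partial z$. For a central hyperplane arrangement $\mathcal{A}$ in $\mathbb{C}^{\ell+1}$ (coordinates $x_1,\dots,x_\ell,z$), with a linear form $\alpha_H$ such that $H=\ker\alpha_H$ chosen for each $H\in\mathcal{A}$, put $D(\mathcal{A})=\{\delta\in\mathrm{Der}_R \mid \delta\alpha_H\in(\alpha_H)\text{ for all }H\in\mathcal{A}\}$, an $R$-module. The arrangement $c\mathrm{Shi}_\ell(m)$ is the central arrangement in $\mathbb{C}^{\ell+1}$ consisting of the hyperplane $z=0$ and the hyperplanes $x_i-x_j-kz=0$ for $1\le i<j\le\ell$ and integers $1-m\le k\le m$. Definite summation: for a polynomial $f(t)$ in $t$ (here with coefficients in $\mathbb{C}[x_1,\dots,x_\ell]$), let $F(t)$ be a polynomial in $t$ (with coefficients in the same ring) with $F(t+1)-F(t)=f(t)$; such $F$ exists and is unique up to adding a constant (an element of the coefficient ring). Define $\Sigma_a^b f(t)\,\Delta t=F(b)-F(a)$. In particular $\Sigma_{x_i}^{x_j}f(t)\Delta t=F(x_j)-F(x_i)\in\mathbb{C}[x_1,\dots,x_\ell]$. Falling power: for an integer $n>0$, $f(t)^{\underline{n}}=f(t)f(t-1)\cdots f(t-n+1)$, and $f(t)^{\underline{0}}=1$.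 Homogenization: for a polynomial vector field $\delta=\sum_{i=1}^\ell f_i(x_1,\dots,x_\ell)\partial_i$ (with $f_i$ not necessarily homogeneous), put $d=\max\{\deg f_1,\dots,\deg f_\ell\}$ and $\widetilde{\delta}=\sum_{i=1}^\ell z^d f_i\bigl(\tfrac{x_1}{z},\dots,\tfrac{x_\ell}{z}\bigr)\partial_i$. *)

(* Defs.v *)
From mathcomp Require Import all_boot all_order all_algebra.
From mathcomp Require Export reals complex mpoly.

Set Implicit Arguments.
Unset Strict Implicit.
Unset Printing Implicit Defensive.

Import Order.TTheory GRing.Theory Num.Theory.
Local Open Scope ring_scope.

(* A finite family [s] of a (left) module is a basis of the submodule [D] if it
   spans exactly [D] and is linearly independent over the coefficient ring. *)
Definition is_basis (A : nzRingType) (V : lmodType A) (D : V -> Prop)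
    (s : seq V) : Prop :=
  (forall v : V, D v <->
     exists c : 'I_(size s) -> A, v = \sum_(i < size s) c i *: s`_i) /\
  (forall c : 'I_(size s) -> A,
     \sum_(i < size s) c i *: s`_i = 0 -> forall i, c i = 0).

Section Derivations.
Variables (K : fieldType) (n : nat).

(* The free module with basis the partial derivatives: the row vector [d]
   stands for the derivation \sum_i (d 0 i) \partial_i. *)
Definition Der := 'rV[{mpoly K[n]}]_n.

Definition partial (i : 'I_n) : Der := delta_mx 0 i.

Definition der_apply (d : Der) (p : {mpoly K[n]}) : {mpoly K[n]} :=
  \sum_(i < n) d 0 i * mderiv i p.

(* A central arrangement is given by the set [arr] of its chosen defining
   linear forms alpha_H, one for each hyperplane H. *)
Definition logDer (arr : {mpoly K[n]} -> Prop) (d : Der) : Prop :=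
  forall alpha, arr alpha -> exists q, der_apply d alpha = q * alpha.

End Derivations.

Section Cone.
Variables (K : fieldType) (l : nat).

(* The coordinates x_1, ..., x_l, z of K^(l+1) : z is the last one. *)
Definition xidx (i : 'I_l) : 'I_l.+1 := lift ord_max i.
Definition zidx : 'I_l.+1 := ord_max.

Definition cx (i : 'I_l) : {mpoly K[l.+1]} := 'X_(xidx i).
Definition cz : {mpoly K[l.+1]} := 'X_zidx.

Definition cShi (m : nat) (alpha : {mpoly K[l.+1]}) : Prop :=
  alpha = cz \/
  exists i j : 'I_l, exists k : int,
    [/\ (i < j)%N, 1 - m%:Z <= k <= m%:Z & alpha = cx i - cx j - cz *~ k].

Definition theta0 : Der K l.+1 := \sum_(i < l) partial K (xidx i).

Definition thetaE : Der K l.+1 :=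
  cz *: partial K zidx + \sum_(i < l) cx i *: partial K (xidx i).

Definition tdeg (f : {mpoly K[l]}) : nat := (msize f).-1.

(* z^d f(x/z), expanded monomial by monomial; see [homog_polyE]. *)
Definition homog_poly (d : nat) (f : {mpoly K[l]}) : {mpoly K[l.+1]} :=
  \sum_(u <- msupp f)
     f@_u *: (cz ^+ (d - mdeg u) * \prod_(i < l) cx i ^+ u i).

Definition homogenize (d : Der K l) : Der K l.+1 :=
  let deg := \max_(i < l) tdeg (d 0%R i) in
  \sum_(i < l) homog_poly deg (d 0 i) *: partial K (xidx i).

Lemma homog_polyE (d : nat) (f : {mpoly K[l]}) : (tdeg f <= d)%N ->
  tofrac (homog_poly d f) =
    tofrac cz ^+ d *
    mmap (fun c : K => tofrac c%:MP_[l.+1])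
         (fun i : 'I_l => tofrac (cx i) / tofrac cz) f.
Proof.
move=> led; rewrite /homog_poly /mmap rmorph_sum /= mulr_sumr.
have cz0 : tofrac cz != 0 by rewrite tofrac_eq0 /cz -msize_poly_eq0 msizeX.
apply: eq_big_seq => u uf.
have leu : (mdeg u <= d)%N.
  apply: leq_trans led; rewrite /tdeg -ltnS.
  by apply: leq_trans (msize_mdeg_lt uf) (leqSpred _).
rewrite -mul_mpolyC !rmorphM rmorphXn rmorph_prod /= [RHS]mulrCA; congr (_ * _).
rewrite /mmap1 -[in RHS](subnK leu) exprD -mulrA; congr (_ * _).
rewrite mdegE expr_sum -big_split /=; apply: eq_bigr => i _.
by rewrite rmorphXn /= -exprMn mulrC divfK.
Qed.

End Cone.

Section Summation.
Variables (K : numFieldType) (l : nat).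
Local Notation A := {mpoly K[l]}.

Definition is_antidifference (f F : {poly A}) : bool :=
  F \Po ('X + 1) - F == f.

Lemma antidifference_exists (f : {poly A}) : exists F, is_antidifference f F.
Proof.
suff H n : forall g : {poly A}, (size g <= n)%N ->
    exists F, is_antidifference g F by exact: (H _ f (leqnn _)).
elim: n => [|n IHn] g.
  rewrite leqn0 size_poly_eq0 => /eqP ->.
  by exists 0; rewrite /is_antidifference comp_poly0 subr0.
move=> sg.
pose c : A := n.+1%:R^-1 *: g`_n.
pose G : {poly A} := c *: 'X^(n.+1).
pose h : {poly A} := \sum_(i < n) 'X^i *+ 'C(n.+1, i).
have cE : c *+ n.+1 = g`_n.
  by rewrite -scaler_nat scalerA mulfV ?scale1r // pnatr_eq0.
have GE : G \Po ('X + 1) - G = c *: h + g`_n *: 'X^n.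
  rewrite /G comp_polyZ comp_Xn_poly exprD1n -scalerBr.
  rewrite !big_ord_recr /= binn mulr1n addrK binSn -/h.
  by rewrite scalerDr -scalerMnr scalerMnl cE.
have sh : (size h <= n)%N.
  apply: (leq_trans (size_sum _ _ _)); apply/bigmax_leqP => i _.
  apply: leq_trans (_ : size ('X^i : {poly A}) <= n)%N.
    by rewrite -scaler_nat size_scale_leq.
  by rewrite size_polyXn.
have [|F /eqP FE] := IHn (g - (G \Po ('X + 1) - G)).
  apply/leq_sizeP => j; rewrite leq_eqVlt => /orP [/eqP <-|nj].
    rewrite GE coefB coefD !coefZ coefXn eqxx mulr1.
    by rewrite (nth_default _ sh) mulr0 add0r subrr.
  rewrite GE coefB coefD !coefZ coefXn gtn_eqF // mulr0 addr0.
  rewrite (nth_default _ (leq_trans sg nj)).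
  by rewrite (nth_default _ (leq_trans sh (ltnW nj))) mulr0 subr0.
exists (F + G); apply/eqP; rewrite comp_polyD.
move: (F \Po _) (G \Po _) FE => F1 G1 FE.
rewrite opprD addrACA FE.
exact: subrK.
Qed.

Definition antidifference (f : {poly A}) : {poly A} :=
  xchoose (antidifference_exists f).

(* The chosen antidifference is immaterial; see [defsumE]. *)
Definition defsum (a b : A) (f : {poly A}) : A :=
  (antidifference f).[b] - (antidifference f).[a].

Lemma defsumE (f F : {poly A}) (a b : A) :
  F \Po ('X + 1) - F = f -> defsum a b f = F.[b] - F.[a].
Proof.
move=> FE; rewrite /defsum.
set G := antidifference f.
have GE : G \Po ('X + 1) - G = f by apply/eqP/(xchooseP (antidifference_exists f)).
pose H := G - F - (G - F).[0]%:P.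
have HE : H \Po ('X + 1) = H.
  have GF : G \Po ('X + 1) = F \Po ('X + 1) - F + G by rewrite FE -GE subrK.
  rewrite /H !comp_polyB comp_polyC GF; congr (_ - _).
  by rewrite addrAC [_ - F - _]addrAC subrr sub0r addrC.
have H0 k : H.[k%:R] = 0.
  elim: k => [|k IHk]; first by rewrite /H hornerD hornerN hornerC subrr.
  by move: IHk; rewrite -{1}HE horner_comp !hornerE natr1.
have Hz : H = 0.
  apply: contraTeq isT => Hn0.
  have := max_poly_roots (rs := [seq k%:R | k <- iota 0 (size H)]) Hn0.
  rewrite size_map size_iota ltnn; apply.
    by apply/allP => _ /mapP [k _ ->]; apply/eqP.
  rewrite map_inj_uniq ?iota_uniq // => i j /eqP.
  by rewrite -!mpolyC_nat mpolyC_eq eqr_nat => /eqP.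
have -> : G = F + (G - F).[0]%:P.
  by apply/eqP; rewrite addrC -subr_eq -subr_eq0; apply/eqP.
by rewrite !hornerD !hornerC opprD addrACA subrr addr0.
Qed.

End Summation.

Section Tau.
Variables (K : numFieldType) (l : nat).
Local Notation A := {mpoly K[l]}.

Definition falling (f : {poly A}) (n : nat) : {poly A} :=
  \prod_(j < n) (f \Po ('X - j%:R)).

Definition gpoly : {poly A} := \prod_(i < l) ('X - ('X_i)%:P).

(* The index k is counted from 0, as are the variables. *)
Definition gk (m k : nat) : {poly A} :=
  falling gpoly m.-1 *
  \prod_(i < l | (i < k)%N) ('X - ('X_i)%:P + 1) *
  \prod_(i < l | (k < i)%N) ('X - ('X_i)%:P - m%:R + 1).

Definition tau (m k : nat) : Der K l :=
  \sum_(i < l) (\sum_(j < l) defsum 'X_i 'X_j (gk m k)) *: partial K i.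

Definition shi_fields (m : nat) : seq (Der K l.+1) :=
  [seq homogenize (tau m k) - homogenize (tau m k.+1) | k <- iota 0 l.-1]
    ++ [:: theta0 K l; thetaE K l].

End Tau.

(* Main.v *)
Require Import Defs.
From mathcomp Require Import all_boot all_order all_algebra.
From mathcomp Require Import ring zify.

(* By Saito's criterion it suffices that the fields are logarithmic and that
   their determinant is a nonzero scalar multiple of the product Q of the
   defining forms.  Membership: (tau_k)(x_i - x_j) is l times the sum of g_k
   between x_i and x_j, and for x_i = x_j + p with 1 - m <= p <= m this is a sum
   over zeros of g_k.  Determinant: Q divides it, and the degrees of the two
   agree, so it only has to be nonzero, which may be checked at z = 1.  If
   f = \sum_k w_k (g_k - g_(k+1)) has all its sums between the x_a equal to 0,
   then, f vanishing at x_a, ..., x_a + m - 2, an antidifference F of f takes the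
   same value at the l m points x_a + s, s < m; as deg F < l m, F is constant and
   f = 0, and evaluating at x_k - 1 for successive k gives w_k = 0. *)

Set Implicit Arguments.
Unset Strict Implicit.
Unset Printing Implicit Defensive.

Import Order.TTheory GRing.Theory Num.Theory.
Local Open Scope ring_scope.

(** * Divisibility and Saito's criterion *)

Section Divides.
Variable A : comNzRingType.
Implicit Types a b p q : A.

Definition divides a p := exists q, p = q * a.

(** Units satisfy this condition too; they are excluded by the separate hypothesis
    [~ divides a 1]. *)
Definition prime_elt a :=
  forall p q, divides a (p * q) -> divides a p \/ divides a q.

Lemma dividesD a p q : divides a p -> divides a q -> divides a (p + q).
Proof. by move=> [u ->] [v ->]; exists (u + v); rewrite mulrDl. Qed.

Lemma dividesMl a p q : divides a q -> divides a (p * q).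
Proof. by move=> [v ->]; exists (p * v); rewrite mulrA. Qed.

Lemma dividesMr a p q : divides a p -> divides a (p * q).
Proof. by rewrite mulrC; exact: dividesMl. Qed.

Lemma divides0 a : divides a 0.
Proof. by exists 0; rewrite mul0r. Qed.

Lemma dividesN a p : divides a p -> divides a (- p).
Proof. by move=> [u ->]; exists (- u); rewrite mulNr. Qed.

Lemma dividesNl a p : divides a p -> divides (- a) p.
Proof. by move=> [u ->]; exists (- u); rewrite mulrNN. Qed.

Lemma divides_sum a I (r : seq I) (P : pred I) (F : I -> A) :
  (forall i, P i -> divides a (F i)) -> divides a (\sum_(i <- r | P i) F i).
Proof.
move=> aF; elim/big_ind: _ => //; first exact: divides0.
exact: dividesD.
Qed.

Lemma divides_prod a I (r : seq I) (P : pred I) (F : I -> A) :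
  prime_elt a -> ~ divides a 1 -> divides a (\prod_(i <- r | P i) F i) ->
  exists i, P i /\ divides a (F i).
Proof.
move=> pa a1; apply: (big_ind (fun x => divides a x -> _)) => //.
  by move=> x y Hx Hy /pa [/Hx|/Hy].
by move=> i Pi aF; exists i.
Qed.

Lemma divides_horner (F : {poly A}) (a b : A) :
  divides (a - b) (F.[a] - F.[b]).
Proof.
have /factor_theorem [q E] : root (F - F.[b]%:P) b.
  by apply/rootP; rewrite !hornerE subrr.
by exists q.[a]; rewrite -[F.[b]](hornerC _ a) -hornerN -hornerD E !hornerE.
Qed.

End Divides.

(** Write p as q times the product of the tail. The head a is prime, so it divides q, as wanted, or
    some member b of the tail; then a = b, against [uniq]. *)
Lemma prod_divides (A : idomainType) (s : seq A) (p : A) : uniq s ->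
    (forall a, a \in s -> prime_elt a /\ ~ divides a 1) ->
    (forall a b, a \in s -> b \in s -> divides a b -> a = b) ->
  (forall a, a \in s -> divides a p) -> divides (\prod_(a <- s) a) p.
Proof.
elim: s => [|a s IHs] /=; first by exists p; rewrite big_nil mulr1.
move=> /andP [nas us] Hp Hd Ha.
have [|||q E] := IHs us.
- by move=> b bs; apply: Hp; rewrite inE bs orbT.
- by move=> b c bs cs; apply: Hd; rewrite inE ?bs ?cs orbT.
- by move=> b bs; apply: Ha; rewrite inE bs orbT.
have as_ : a \in a :: s by rewrite inE eqxx.
have [pa a1] := Hp a as_.
have := Ha a as_; rewrite E => /pa [[r ->]|].
  by exists r; rewrite big_cons mulrA.
rewrite big_seq_cond => /(divides_prod pa a1) [b [/andP [bs _]]].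
move=> /(Hd a b as_); rewrite inE bs orbT => /(_ isT) ab.
by rewrite ab bs in nas.
Qed.

(** * Substitution for a variable, and primality of x_v - b *)

Section Substitution.
Variables (K : fieldType) (n : nat) (v : 'I_n) (b : {mpoly K[n]}).

Definition subst_var : n.-tuple {mpoly K[n]} :=
  [tuple (if i == v then b else 'X_i) | i < n].

(** Congruence modulo x_v - b is compatible with sums and products, so it is enough to compare the
    variables. *)
Lemma divides_subst (p : {mpoly K[n]}) :
  divides ('X_v - b) (p - (p \mPo subst_var)).
Proof.
have -> : p - (p \mPo subst_var) =
    \sum_(u <- msupp p) (p@_u *: 'X_[u] - p@_u *: ('X_[u] \mPo subst_var)).
  by rewrite sumrB -mpolyE -comp_mpolyEX.
apply: divides_sum => u _; rewrite -scalerBr -mul_mpolyC; apply: dividesMl.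
rewrite comp_mpolyX (mpolyXE_id _ u).
apply: (big_ind2 (fun x y => divides ('X_v - b) (x - y))) => [|x y z w xy zw|i _].
- by rewrite subrr; exact: divides0.
- have -> : x * z - y * w = (x - y) * z + y * (z - w) by ring.
  by apply: dividesD; [exact: dividesMr|exact: dividesMl].
rewrite tnth_mktuple subrXX; apply: dividesMr.
by case: eqP => [->|_]; [exists 1; rewrite mul1r|rewrite subrr; exact: divides0].
Qed.

(** The hypothesis holds when b is free of x_v. It makes x_v - b a generator of the kernel of the
    substitution, hence prime, as the target is a domain. *)
Lemma divides_substE (p : {mpoly K[n]}) : (b \mPo subst_var) = b ->
  divides ('X_v - b) p <-> (p \mPo subst_var) = 0.
Proof.
move=> bE; split=> [[q ->]|p0]; last by rewrite -[p]subr0 -p0; exact: divides_subst.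
rewrite rmorphM rmorphB /= bE comp_mpolyXU -tnth_nth tnth_mktuple eqxx.
by rewrite subrr mulr0.
Qed.

Lemma prime_elt_subst : (b \mPo subst_var) = b -> prime_elt ('X_v - b).
Proof.
move=> bE p q /(divides_substE _ bE) /eqP; rewrite rmorphM mulf_eq0.
by case/orP => /eqP /= E; [left|right]; apply/divides_substE.
Qed.

Lemma nondivides1_subst : (b \mPo subst_var) = b -> ~ divides ('X_v - b) 1.
Proof. by move=> bE /(divides_substE _ bE) /eqP; rewrite rmorph1 oner_eq0. Qed.

End Substitution.

(** * Logarithmic derivations and determinants *)

Section Saito.
Variables (K : fieldType) (n : nat).
Local Notation R := {mpoly K[n]}.
Implicit Types (M : 'M[R]_n) (d : Der K n) (a : R).

Lemma der_apply0 a : der_apply (0 : Der K n) a = 0.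
Proof. by rewrite /der_apply big1 // => i _; rewrite mxE mul0r. Qed.

Lemma der_applyD d1 d2 a :
  der_apply (d1 + d2) a = der_apply d1 a + der_apply d2 a.
Proof.
by rewrite /der_apply -big_split; apply: eq_bigr => i _; rewrite mxE mulrDl.
Qed.

Lemma der_applyZ c d a : der_apply (c *: d) a = c * der_apply d a.
Proof.
by rewrite /der_apply mulr_sumr; apply: eq_bigr => i _; rewrite mxE mulrA.
Qed.

Lemma logDer_comb (arr : R -> Prop) I (r : seq I) (P : pred I) (c : I -> R)
    (F : I -> Der K n) :
  (forall i, P i -> logDer arr (F i)) ->
  logDer arr (\sum_(i <- r | P i) c i *: F i).
Proof.
move=> FD a aa; apply: (big_ind (fun d => divides a (der_apply d a))).
- by rewrite der_apply0; exact: divides0.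
- by move=> d1 d2 D1 D2; rewrite der_applyD; exact: dividesD.
- by move=> i Pi; rewrite der_applyZ; apply/dividesMl/FD.
Qed.

(* M applied to the gradient of a is divisible by a; multiply by the adjugate. *)
Lemma divides_det M a (v : 'I_n) : mderiv v a = 1 ->
  (forall i, divides a (der_apply (row i M) a)) -> divides a (\det M).
Proof.
move=> a1 Ma; pose c : 'cV[R]_n := \col_j mderiv j a.
have E : \det M = (\adj M *m (M *m c)) v 0.
  by rewrite mulmxA mul_adj_mx mul_scalar_mx !mxE a1 mulr1.
rewrite E mxE; apply: divides_sum => i _; apply: dividesMl.
rewrite mxE; have := Ma i; rewrite /der_apply; congr divides.
by apply: eq_bigr => j _; rewrite !mxE.
Qed.

(** Trades the index type ['I_(size s)] for ['I_k], so that the family can form the rows of a square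
    matrix. *)
Lemma is_basis_size (V : lmodType R) (D : V -> Prop) (s : seq V) k :
  size s = k ->
  (forall v : V, D v <-> exists c : 'I_k -> R, v = \sum_(i < k) c i *: s`_i) ->
  (forall c : 'I_k -> R, \sum_(i < k) c i *: s`_i = 0 -> forall i, c i = 0) ->
  is_basis D s.
Proof. by move=> <-; split. Qed.

(** Multiplying a relation by the adjugate gives independence, the determinant being nonzero. For
    spanning, Cramer's rule writes the coefficients of d as determinants with logarithmic rows over
    [\det M]; the product Q of the forms divides each of them, and [\det M] is Q up to a nonzero
    scalar. *)
Lemma saito (arr : R -> Prop) (forms : seq R) (s : seq (Der K n)) u :
    size s = n -> uniq forms -> (forall a, a \in forms <-> arr a) ->
    (forall a, arr a -> [/\ prime_elt a, ~ divides a 1 &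
                            exists v, mderiv v a = 1]) ->
    (forall a b, arr a -> arr b -> divides a b -> a = b) ->
    (forall i, (i < n)%N -> logDer arr s`_i) ->
    u != 0 ->
    \det (\matrix_(i < n) s`_i : 'M[R]_n) = u *: \prod_(a <- forms) a ->
  is_basis (logDer arr) s.
Proof.
move=> ss uf fE Hp Hd sD u0 detE; set M : 'M[R]_n := \matrix_i _ in detE.
have Mrow i : row i M = s`_i by rewrite rowK.
have combE (c : 'I_n -> R) :
    \sum_(i < n) c i *: s`_i = (\row_i c i) *m M.
  rewrite mulmx_sum_row; apply: eq_bigr => i _.
  by rewrite Mrow mxE.
have Qdet (N : 'M[R]_n) : (forall i, logDer arr (row i N)) ->
    divides (\prod_(a <- forms) a) (\det N).
  move=> ND; apply: prod_divides => //.
  - by move=> a /fE /Hp [].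
  - by move=> a b /fE aa /fE ab; exact: Hd.
  - move=> a /fE aa; have [_ _ [v av]] := Hp a aa.
    by apply: (divides_det av) => i; exact: ND.
have Q0 : \prod_(a <- forms) a != 0.
  rewrite prodf_seq_neq0; apply/allP => a /fE /Hp [_ _ [v av]] /=.
  by apply: contra_eq_neq av => ->; rewrite mderiv0 eq_sym oner_neq0.
have det0 : \det M != 0 by rewrite detE scaler_eq0 negb_or u0.
apply: (is_basis_size ss) => [d|c]; last first.
  rewrite combE => /(congr1 (mulmx^~ (\adj M))).
  rewrite -mulmxA mul_mx_adj mul_mx_scalar mul0mx => /rowP c0 i.
  by have /eqP := c0 i; rewrite !mxE mulf_eq0 (negPf det0) => /eqP.
split=> [dD|[c ->]]; last by apply: logDer_comb => i _; exact: sD.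
(* Entry i of d times the adjugate is the determinant of M with row i replaced by d, hence a
   multiple of Q. *)
have [c cE] : exists c : 'I_n -> R, forall i,
    (d *m \adj M) 0 i = c i * \prod_(a <- forms) a.
  apply: (@fin_all_exists 'I_n (fun=> R)
    (fun i q => (d *m \adj M) 0 i = q * \prod_(a <- forms) a)) => i.
  pose N := \matrix_(j < n) if j == i then d else row j M.
  have -> : (d *m \adj M) 0 i = \det N.
    rewrite (expand_det_row _ i) mxE; apply: eq_bigr => j _.
    have -> : cofactor N i j = \adj M j i.
      have rN : row' i (col' j N) = row' i (col' j M).
        by apply/matrixP => x y; rewrite !mxE eq_sym (negPf (neq_lift _ _)) !mxE.
      by rewrite mxE /cofactor rN.
    by rewrite [N _ _]mxE eqxx.
  apply: Qdet => j; rewrite rowK; case: eqP => // _.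
  by rewrite Mrow; exact: sD.
exists (fun i => u^-1 *: c i); rewrite combE.
suff E : \det M *: d = \det M *: ((\row_i (u^-1 *: c i)) *m M).
  by apply/rowP => j; have /rowP/(_ j) := E; rewrite !mxE => /(mulfI det0).
rewrite -[LHS]mul_mx_scalar -mul_adj_mx mulmxA scalemxAl; congr (_ *m M).
by apply/rowP => i; rewrite cE detE !mxE -scalerAl mulrC -scalerAr scalerA
  divff ?scale1r.
Qed.

End Saito.

(** * Degrees and antidifferences *)

Section Degree.
Variables (K : fieldType) (n : nat).
Local Notation A := {mpoly K[n]}.

Lemma msizeD_leq (p q : A) k :
  (msize p <= k)%N -> (msize q <= k)%N -> (msize (p + q) <= k)%N.
Proof.
by move=> pk qk; apply: leq_trans (msizeD_le _ _) _; rewrite geq_max pk qk.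
Qed.

Lemma msize_sum_leq I (r : seq I) (P : pred I) (F : I -> A) k :
  (forall i, P i -> (msize (F i) <= k)%N) ->
  (msize (\sum_(i <- r | P i) F i) <= k)%N.
Proof.
move=> Fk; elim/big_ind: _ => //; first by rewrite mmeasure0.
by move=> p q; exact: msizeD_leq.
Qed.

Lemma msizeM_pred (p q : A) : p != 0 -> q != 0 ->
  msize (p * q) = (msize p + msize q).-1.
Proof. exact: msizeM. Qed.

Lemma msizeM_leq (p q : A) a b :
  (msize p <= a.+1)%N -> (msize q <= b.+1)%N -> (msize (p * q) <= (a + b).+1)%N.
Proof.
have [->|p0] := eqVneq p 0; first by rewrite mul0r mmeasure0.
have [->|q0] := eqVneq q 0; first by rewrite mulr0 mmeasure0.
by move=> pa qb; rewrite msizeM_pred //; lia.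
Qed.

Lemma msize_prod_leq (I : finType) (F : I -> A) (d : I -> nat) :
  (forall i, (msize (F i) <= (d i).+1)%N) ->
  (msize (\prod_i F i) <= (\sum_i d i).+1)%N.
Proof.
move=> Fd; apply: (big_ind2 (fun p k => (msize p <= k.+1)%N)) => //.
  by rewrite msize1.
by move=> p a q b; exact: msizeM_leq.
Qed.

(** Every factor adds at least 1 to the degree. This will bound the degree of the product of the
    defining forms from below. *)
Lemma msize_prod_geq (s : seq A) : (forall a, a \in s -> (1 < msize a)%N) ->
  (size s < msize (\prod_(a <- s) a))%N.
Proof.
elim: s => [|a s IHs] sa; first by rewrite big_nil msize1.
have a1 : (1 < msize a)%N by apply: sa; rewrite inE eqxx.
have sP : (size s < msize (\prod_(a <- s) a))%N.
  by apply: IHs => b bs; apply: sa; rewrite inE bs orbT.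
have aux k x y : (1 < x -> k < y -> k.+1 < (x + y).-1)%N by lia.
rewrite big_cons msizeM_pred; first exact: aux a1 sP.
  by rewrite -msize_poly_eq0 -lt0n ltnW.
by rewrite -msize_poly_eq0 -lt0n (leq_trans _ sP).
Qed.

Lemma msize_det_leq (M : 'M[A]_n) (d : 'I_n -> nat) :
  (forall i j, (msize (M i j) <= (d i).+1)%N) ->
  (msize (\det M) <= (\sum_i d i).+1)%N.
Proof.
move=> Md; apply: msize_sum_leq => s _.
rewrite -[X in (_ <= X.+1)%N]add0n; apply: msizeM_leq; last exact: msize_prod_leq.
by case: (perm.odd_perm s); rewrite ?expr1 ?expr0 ?mmeasureN msize1.
Qed.

(* The total degree of f, jointly in the polynomial variable and the X_i, is
   at most d; the truncated subtraction forces f`_a = 0 for a > d. *)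
Definition joint_degree_le d (f : {poly A}) :=
  forall a, (msize f`_a <= d.+1 - a)%N.

Lemma joint_degreeD d f g : joint_degree_le d f -> joint_degree_le d g ->
  joint_degree_le d (f + g).
Proof. by move=> fd gd a; rewrite coefD; apply: msizeD_leq. Qed.

Lemma joint_degreeN d f : joint_degree_le d f -> joint_degree_le d (- f).
Proof. by move=> fd a; rewrite coefN mmeasureN. Qed.

Lemma joint_degreeM d e f g : joint_degree_le d f -> joint_degree_le e g ->
  joint_degree_le (d + e) (f * g).
Proof.
move=> fd ge a; rewrite coefM; apply: msize_sum_leq => i _.
(* For nonzero factors the bounds force i <= d and a - i <= e, so the truncated subtractions are
   exact. *)
have [->|f0] := eqVneq f`_i 0; first by rewrite mul0r mmeasure0.
have [->|g0] := eqVneq g`_(a - i) 0; first by rewrite mulr0 mmeasure0.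
have := fd i; have := ge (a - i)%N.
move: f0 g0; rewrite -!msize_poly_eq0 => f0 g0.
by rewrite msizeM_pred -?msize_poly_eq0 //; have := ltn_ord i; lia.
Qed.

Lemma joint_degree_linear (c : A) : (msize c <= 2)%N ->
  joint_degree_le 1 ('X - c%:P).
Proof.
move=> c2 [|[|a]]; rewrite coefB coefX coefC /=.
- by rewrite sub0r mmeasureN.
- by rewrite subr0 msize1.
- by rewrite subr0 mmeasure0.
Qed.

Lemma msize_horner_leq d (f : {poly A}) (c : A) : (msize c <= 2)%N ->
  joint_degree_le d f -> (msize f.[c] <= d.+1)%N.
Proof.
move=> c2 fd; rewrite horner_coef; apply: msize_sum_leq => i _.
have cX : (msize (c ^+ i) <= i.+1)%N.
  elim: (i : nat) => [|k IHk]; first by rewrite expr0 msize1.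
  by rewrite exprS -[k.+1]add1n; apply: msizeM_leq.
have [->|f0] := eqVneq f`_i 0; first by rewrite mul0r mmeasure0.
have [->|g0] := eqVneq (c ^+ i) 0; first by rewrite mulr0 mmeasure0.
have aux (j k x y : nat) :
  (x != 0 -> x <= k.+1 - j -> y <= j.+1 -> (x + y).-1 <= k.+1)%N by lia.
by rewrite msizeM_pred //; apply: aux (fd i) cX; rewrite msize_poly_eq0.
Qed.

End Degree.

(** * Degree bounds, linearity and telescoping for antidifferences *)

Section Antidifference.
Variables (K : numFieldType) (l : nat).
Local Notation A := {mpoly K[l]}.

(* The antidifference is built as in [antidifference_exists], keeping track of
   both degrees. *)
Lemma antidifference_degree (f : {poly A}) :
  exists F : {poly A}, [/\ F \Po ('X + 1) - F = f, (size F <= (size f).+1)%N &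
    forall d, joint_degree_le d f -> joint_degree_le d.+1 F].
Proof.
suff H n : forall g : {poly A}, (size g <= n)%N ->
    exists F : {poly A}, [/\ F \Po ('X + 1) - F = g, (size F <= n.+1)%N &
    forall d, joint_degree_le d g -> joint_degree_le d.+1 F].
  exact: (H _ f (leqnn _)).
elim: n => [|n IHn] g.
  rewrite leqn0 size_poly_eq0 => /eqP ->; exists 0.
  rewrite comp_poly0 subr0 size_poly0; split=> // d _ a.
  by rewrite coef0 mmeasure0.
move=> sg.
(* This c gives D, the difference of c t^(n+1), the same coefficient of t^n as g, so that the
   induction hypothesis applies to g - D. *)
pose c : A := n.+1%:R^-1 *: g`_n.
have n0 : (n.+1%:R : K) != 0 by rewrite pnatr_eq0.
have cE : c *+ n.+1 = g`_n.
  by rewrite -scaler_nat scalerA mulfV ?scale1r.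
pose G : {poly A} := c *: 'X^(n.+1).
pose D : {poly A} := \sum_(i < n.+1) c *+ 'C(n.+1, i) *: 'X^i.
have GE : G \Po ('X + 1) - G = D.
  rewrite /G comp_polyZ comp_Xn_poly exprD1n -scalerBr big_ord_recr /= binn.
  rewrite mulr1n addrK scaler_sumr; apply: eq_bigr => i _.
  by rewrite -scalerMnr scalerMnl.
have DE a : D`_a = if (a < n.+1)%N then c *+ 'C(n.+1, a) else 0.
  rewrite /D -(poly_def n.+1 (fun i => c *+ 'C(n.+1, i))) coef_poly.
  by [].
have [|F [FE sF dF]] := IHn (g - D).
  apply/leq_sizeP => j; rewrite coefB DE ltnS leq_eqVlt => /orP [/eqP <-|nj].
    by rewrite leqnn binSn cE subrr.
  by rewrite leqNgt nj /= nth_default ?subrr // (leq_trans sg).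
exists (F + G); split.
- rewrite comp_polyD opprD addrACA.
  by move: (F \Po _) (G \Po _) FE GE => F1 G1 -> ->; rewrite subrK.
- apply: leq_trans (size_polyD _ _) _; rewrite geq_max (leq_trans sF) //=.
  by rewrite (leq_trans (size_scale_leq _ _)) // size_polyXn.
move=> d gd.
(* The bound on c suffices: D has coefficients only at t^a with a <= n, and G only at t^(n+1). *)
have cd : (msize c <= d.+1 - n)%N by apply: leq_trans (msizeZ_le _ _) (gd n).
apply: joint_degreeD.
  apply: dF; apply: joint_degreeD => //; apply: joint_degreeN => a.
  rewrite DE; case: ltnP => an; last by rewrite mmeasure0.
  rewrite -scaler_nat; apply: leq_trans (msizeZ_le _ _) _.
  by apply: leq_trans cd _; lia.
move=> a; rewrite coefZ coefXn; case: eqP => [->|_].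
  by rewrite mulr1; apply: leq_trans cd _; lia.
by rewrite mulr0 mmeasure0.
Qed.

Lemma defsum_comb (I : Type) (r : seq I) (P : pred I) (c : I -> A)
    (f : I -> {poly A}) (a b : A) :
  defsum a b (\sum_(i <- r | P i) c i *: f i) =
  \sum_(i <- r | P i) c i * defsum a b (f i).
Proof.
pose F i := antidifference (f i).
have FE i : F i \Po ('X + 1) - F i = f i.
  by apply/eqP/(xchooseP (antidifference_exists (f i))).
rewrite (defsumE (F := \sum_(i <- r | P i) c i *: F i)); last first.
  rewrite [_ \Po _]raddf_sum -sumrB; apply: eq_bigr => i _.
  by rewrite /= comp_polyZ -scalerBr FE.
rewrite !horner_sum -sumrB; apply: eq_bigr => i _.
by rewrite !hornerZ -mulrBr.
Qed.

Lemma defsumB (a b : A) f g : defsum a b (f - g) = defsum a b f - defsum a b g.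
Proof.
have [F [FE _ _]] := antidifference_degree f.
have [G [GE _ _]] := antidifference_degree g.
rewrite (defsumE _ _ FE) (defsumE _ _ GE) (defsumE (F := F - G)).
  by rewrite !hornerD !hornerN [in LHS]opprD addrACA opprD.
rewrite comp_polyB; move: (F \Po _) (G \Po _) FE GE => F1 G1 <- <-.
by rewrite !opprD addrACA.
Qed.

Lemma defsum_subr (a b c : A) f : defsum a c f - defsum b c f = defsum a b f.
Proof. by rewrite /defsum; ring. Qed.

Lemma msize_defsum d (a b : A) f : joint_degree_le d f ->
  (msize a <= 2)%N -> (msize b <= 2)%N -> (msize (defsum a b f) <= d.+2)%N.
Proof.
have [F [FE _ dF]] := antidifference_degree f => /dF fd a2 b2.
rewrite (defsumE _ _ FE); apply: msizeD_leq; rewrite ?mmeasureN;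
  exact: msize_horner_leq.
Qed.

Lemma horner_antidifference (F f : {poly A}) (a : A) :
  F \Po ('X + 1) - F = f -> F.[a + 1] = F.[a] + f.[a].
Proof.
move=> <-; rewrite hornerD hornerN horner_comp.
have -> : ('X + 1 : {poly A}).[a] = a + 1 by rewrite !hornerE.
by rewrite [RHS]addrC subrK.
Qed.

Lemma horner_antidifferenceD (F f : {poly A}) (a : A) q :
  F \Po ('X + 1) - F = f ->
  F.[a + q%:R] = F.[a] + \sum_(s < q) f.[a + s%:R].
Proof.
move=> FE; elim: q => [|q IHq]; first by rewrite big_ord0 !addr0.
by rewrite -natr1 addrA (horner_antidifference _ FE) IHq big_ord_recr addrA.
Qed.

End Antidifference.

(** * The polynomials g_k and the fields tau_k *)

Section ShiPolynomials.
Variables (K : numFieldType) (l : nat).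
Local Notation A := {mpoly K[l]}.

Lemma mpolyX_inj : injective (fun i : 'I_l => 'X_i : A).
Proof.
move=> i j /(congr1 (meval (fun k => (k == i)%:R : K))).
by rewrite !mevalXU eqxx; case: eqP => // _ /eqP; rewrite oner_eq0.
Qed.

Lemma msizeXU (i : 'I_l) : msize ('X_i : A) = 2.
Proof. by rewrite msizeX mdeg1. Qed.

Lemma msize_nat_leq q : (msize (q%:R : A) <= 1)%N.
Proof. by rewrite -mpolyC_nat mmeasureC; case: eqP. Qed.

(** The zeros of g_k in t, with multiplicity: the falling power gives x_i, ..., x_i + m - 2 for
    every i, the other factors give x_i - 1 for i < k and x_i + m - 1 for i > k. *)
Definition gk_roots (m k : nat) : seq A :=
  [seq 'X_i + (val j)%:R | j <- enum 'I_m.-1, i <- enum 'I_l] ++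
  [seq if (i < k)%N then 'X_i - 1 else 'X_i + m.-1%:R
     | i : 'I_l <- enum 'I_l & val i != k].

Lemma gkE m k : (0 < m)%N -> gk K l m k = \prod_(c <- gk_roots m k) ('X - c%:P).
Proof.
case: m => // m _; rewrite /gk /gk_roots big_cat big_allpairs_dep -mulrA /=.
congr (_ * _).
  rewrite /falling big_enum; apply: eq_bigr => j _.
  rewrite /gpoly rmorph_prod big_enum; apply: eq_bigr => i _ /=.
  rewrite comp_polyB comp_polyX comp_polyC polyCD polyC_natr.
  by rewrite opprD addrA addrAC.
rewrite big_map big_filter big_enum_cond [RHS](bigID (fun i : 'I_l => (i < k)%N)).
congr (_ * _); apply: eq_big => i /=.
- by case: ltngtP.
- by move=> ->; rewrite polyCB polyC1; ring.
- by case: ltngtP.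
by rewrite ltnNge leq_eqVlt negb_or => /andP [_ /negPf ->];
  rewrite polyCD polyC_natr -natr1; ring.
Qed.

(** The falling power contributes (m - 1) l zeros, and each of the l - 1 indices other than k one
    more. *)
Lemma size_gk_roots m k : (0 < m)%N -> (k < l)%N ->
  size (gk_roots m k) = (m * l).-1.
Proof.
move=> m0 kl; rewrite size_cat size_allpairs !size_enum_ord size_map.
rewrite size_filter -sumn_count.
have -> : sumn [seq (val i != k : nat) | i <- enum 'I_l] = l.-1.
  rewrite sumnE big_map big_enum /= -[k]/(val (Ordinal kl)).
  under eq_bigr do rewrite (inj_eq val_inj).
  have := cardC1 (Ordinal kl); rewrite card_ord -sum1_card big_mkcond /= => <-.
  by apply: eq_bigr => i _; rewrite !inE; case: eqP.
by case: m m0 => // m _; rewrite mulSn /=; case: l kl => // l' _; rewrite addSn addnC.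
Qed.

Lemma gk_roots_msize m k c : c \in gk_roots m k -> (msize c <= 2)%N.
Proof.
have X2 i (q : nat) : (msize ('X_i + q%:R : A) <= 2)%N.
  apply: msizeD_leq; first by rewrite msizeXU.
  exact: leq_trans (msize_nat_leq _) _.
rewrite mem_cat => /orP [/allpairsP [[j i] /= [_ _ ->]]|/mapP [i _ ->]] //.
case: ifP => // _; apply: msizeD_leq; first by rewrite msizeXU.
by rewrite mmeasureN msize1.
Qed.

Lemma gk_joint_degree m k : (0 < m)%N -> (k < l)%N ->
  joint_degree_le (m * l).-1 (gk K l m k).
Proof.
move=> m0 kl; rewrite -(size_gk_roots m0 kl) gkE //.
elim: (gk_roots m k) (@gk_roots_msize m k) => [|c s IHs] sm.
  by rewrite big_nil => -[|a]; rewrite coef1 ?msize1 //= mmeasure0.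
rewrite big_cons /= -add1n; apply: joint_degreeM.
  by apply/joint_degree_linear/sm; rewrite inE eqxx.
by apply: IHs => b bs; apply: sm; rewrite inE bs orbT.
Qed.

Lemma gk_monic m k : (0 < m)%N -> gk K l m k \is monic.
Proof. by move=> m0; rewrite gkE // monic_prod_XsubC. Qed.

Lemma size_gk m k : (0 < m)%N -> (k < l)%N -> size (gk K l m k) = (m * l).-1.+1.
Proof. by move=> m0 kl; rewrite gkE // size_prod_XsubC size_gk_roots. Qed.

Lemma gk_divides m k (al x c : A) : (0 < m)%N -> c \in gk_roots m k ->
  divides al (x - c) -> divides al (gk K l m k).[x].
Proof.
move=> m0 cr xc; rewrite gkE // (big_rem c) //= hornerM.
by rewrite !hornerE; apply: dividesMr.
Qed.

(** Modulo 0, a congruence is an equality. *)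
Lemma gk_root m k (c : A) : (0 < m)%N -> c \in gk_roots m k ->
  (gk K l m k).[c] = 0.
Proof.
move=> m0 cr; have [|q ->] := @gk_divides m k 0 c c m0 cr.
  by rewrite subrr; exact: divides0.
by rewrite mulr0.
Qed.

Lemma gk_roots_low m k (i : 'I_l) s : (s < m.-1)%N ->
  'X_i + s%:R \in gk_roots m k.
Proof.
move=> sm; rewrite mem_cat; apply/orP; left; apply/allpairsP.
by exists (Ordinal sm, i); rewrite /= !mem_enum.
Qed.

Lemma gk_roots_lt m k (i : 'I_l) : (i < k)%N -> 'X_i - 1 \in gk_roots m k.
Proof.
move=> ik; rewrite mem_cat; apply/orP; right; apply/mapP; exists i.
  by rewrite mem_filter mem_enum neq_ltn ik.
by rewrite ik.
Qed.

Lemma gk_roots_gt m k (i : 'I_l) : (k < i)%N ->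
  'X_i + m.-1%:R \in gk_roots m k.
Proof.
move=> ki; rewrite mem_cat; apply/orP; right; apply/mapP; exists i.
  by rewrite mem_filter mem_enum neq_ltn ki orbT.
by rewrite ltnNge ltnW.
Qed.

(** At the origin x_k - 1 takes the value -1 and x_i + s the value s >= 0; the remaining zeros x_i -
    1 have i < k. *)
Lemma gk_rootsF m (k : 'I_l) c : c \in gk_roots m k -> 'X_k - 1 <> c.
Proof.
have N i s : 'X_k - 1 <> 'X_i + s%:R :> A.
  move=> /(congr1 (meval (fun=> 0 : K))).
  rewrite mevalB mevalD !mevalXU meval1 -mpolyC_nat mevalC => /eqP.
  by rewrite sub0r add0r eq_sym -addr_eq0 natr1 pnatr_eq0.
rewrite mem_cat => /orP [/allpairsP [[j i] /= [_ _ ->]]|/mapP [i + ->]].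
  exact: N.
rewrite mem_filter => /andP [ik _]; case: ifP => // _.
by move/addIr/mpolyX_inj => ki; rewrite ki eqxx in ik.
Qed.

Lemma gk_neq0 m (k : 'I_l) : (0 < m)%N -> (gk K l m k).['X_k - 1] != 0.
Proof.
move=> m0; rewrite gkE // horner_prod prodf_seq_neq0; apply/allP => c /= cr.
rewrite !hornerE subr_eq0; apply/negP => /eqP kc.
exact: gk_rootsF cr kc.
Qed.

(* Modulo x_i = x_j + p the sum runs over |p| consecutive zeros of g_k. *)
Lemma defsum_gk_divides m k (i j : 'I_l) (p : int) : (0 < m)%N ->
  (i < j)%N -> 1 - m%:Z <= p <= m%:Z ->
  divides ('X_i - 'X_j - p%:~R) (defsum 'X_i 'X_j (gk K l m k)).
Proof.
move=> m0 ij pm; set al : A := _ - _ - _.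
have [F [FE _ _]] := antidifference_degree (gk K l m k).
rewrite (defsumE _ _ FE).
case: p pm @al => q pm al.
  have qm : (q <= m)%N by lia.
  (* For p = q >= 0, x_i is congruent to x_j + q, which leaves, up to sign, the sum of g_k over x_j,
     ..., x_j + q - 1. *)
  have -> : F.['X_j] - F.['X_i] =
      - (F.['X_i] - F.['X_j + q%:R]) - (F.['X_j + q%:R] - F.['X_j]) by ring.
  apply: dividesD; apply: dividesN.
    have -> : al = 'X_i - ('X_j + q%:R) by rewrite /al; ring.
    exact: divides_horner.
  rewrite (horner_antidifferenceD _ _ FE) addrAC subrr add0r.
  apply: divides_sum => s _.
  have [sm|sm] := ltnP s m.-1.
    by rewrite gk_root ?gk_roots_low //; exact: divides0.
  (* The point x_j + m - 1 occurs only for q = m. If i < k, it is congruent to the zero x_i - 1;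
     otherwise k <= i < j and it is itself a zero. *)
  have [sE qE] : s = m.-1 :> nat /\ q = m by have := ltn_ord s; lia.
  rewrite sE; have [ik|ki] := ltnP i k.
    apply: (gk_divides m0 (gk_roots_lt _ ik)).
    exists (-1); rewrite /al qE -[in RHS](prednK m0) -pmulrn -natr1; ring.
  rewrite gk_root ?gk_roots_gt ?(leq_ltn_trans ki) //; exact: divides0.
(* Now p = -(q + 1): x_j is congruent to x_i + q + 1, and the points x_i + s of the sum have s <= q
   <= m - 2. *)
have qm : (q.+1 <= m.-1)%N by lia.
have -> : F.['X_j] - F.['X_i] =
    (F.['X_j] - F.['X_i + q.+1%:R]) + (F.['X_i + q.+1%:R] - F.['X_i]) by ring.
apply: dividesD.
  rewrite -[al]opprK; apply: dividesNl.
  have -> : - al = 'X_j - ('X_i + q.+1%:R) by rewrite /al NegzE rmorphN /=; ring.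
  exact: divides_horner.
rewrite (horner_antidifferenceD _ _ FE) addrAC subrr add0r.
apply: divides_sum => s _; rewrite gk_root ?gk_roots_low //.
  exact: divides0.
by have := ltn_ord s; lia.
Qed.

Lemma tauE m k i : tau K l m k 0 i = \sum_j defsum 'X_i 'X_j (gk K l m k).
Proof.
rewrite /tau summxE (bigD1 i) //= [X in _ + X]big1 ?addr0 => [|j ji].
  by rewrite /partial !mxE !eqxx mulr1.
by rewrite /partial !mxE eq_sym (negPf ji) andbF mulr0.
Qed.

(** Each of the l upper limits x_c contributes the same difference, the sum from x_i to x_j. *)
Lemma tau_sub m k i j :
  tau K l m k 0 i - tau K l m k 0 j = defsum 'X_i 'X_j (gk K l m k) *+ l.
Proof.
rewrite !tauE -sumrB.
under eq_bigr do rewrite defsum_subr.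
by rewrite sumr_const card_ord.
Qed.

Lemma msize_tau m k i : (0 < m)%N -> (k < l)%N ->
  (msize (tau K l m k 0%R i) <= (m * l).+1)%N.
Proof.
move=> m0 kl; rewrite tauE; apply: msize_sum_leq => j _.
have E : (m * l).+1 = (m * l).-1.+2.
  by congr S; rewrite prednK // muln_gt0 m0 (leq_trans _ kl).
by rewrite E; apply: msize_defsum; rewrite ?msizeXU //; exact: gk_joint_degree.
Qed.

End ShiPolynomials.

(** * Homogenization *)

(** Read in the fraction field: homogenizing in degree e + 1 a multiple of x - y - p by a factor q
    homogenized in degree e. *)
Lemma dehomog_identity (F : fieldType) (x y z p q : F) e : z != 0 ->
  z * z ^+ e * (q * (x / z - y / z - p)) = z ^+ e * q * (x - y - z * p).
Proof. by move=> z0; field. Qed.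

Section Homogenization.
Variables (K : fieldType) (l : nat).
Local Notation A := {mpoly K[l]}.
Local Notation R := {mpoly K[l.+1]}.

Lemma msize_cx i : msize (cx K i : R) = 2.
Proof. by rewrite /cx msizeX mdeg1. Qed.

Lemma msize_cz : msize (cz K l) = 2.
Proof. by rewrite /cz msizeX mdeg1. Qed.

Lemma cz_neq0 : cz K l != 0.
Proof. by rewrite -msize_poly_eq0 msize_cz. Qed.

Lemma msize_exp_leq (p : R) q : (msize p <= 2)%N -> (msize (p ^+ q) <= q.+1)%N.
Proof.
move=> p2; elim: q => [|q IHq]; first by rewrite expr0 msize1.
by rewrite exprS -[q.+1]add1n; apply: msizeM_leq.
Qed.

Lemma mdeg_tdeg (f : A) d u : (tdeg f <= d)%N -> u \in msupp f ->
  (mdeg u <= d)%N.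
Proof.
move=> fd /msize_mdeg_lt uf; apply: leq_trans fd.
by rewrite /tdeg -ltnS (leq_trans uf) ?leqSpred.
Qed.

Lemma msize_homog_poly d (f : A) : (tdeg f <= d)%N ->
  (msize (homog_poly d f) <= d.+1)%N.
Proof.
move=> fd; rewrite /homog_poly big_seq_cond; apply: msize_sum_leq => u.
rewrite andbT => /(mdeg_tdeg fd) ud; apply: leq_trans (msizeZ_le _ _) _.
rewrite -[X in (_ <= X.+1)%N](subnK ud) mdegE; apply: msizeM_leq.
  by apply: msize_exp_leq; rewrite msize_cz.
by apply: msize_prod_leq => i; apply: msize_exp_leq; rewrite msize_cx.
Qed.

Definition dehomogenize_vars : l.+1.-tuple A :=
  [tuple (if unlift ord_max i is Some j then 'X_j else 1) | i < l.+1].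

Lemma dehomogenize_cx i : (cx K i \mPo dehomogenize_vars) = 'X_i.
Proof. by rewrite /cx comp_mpolyXU -tnth_nth tnth_mktuple /xidx liftK. Qed.

Lemma dehomogenize_cz : (cz K l \mPo dehomogenize_vars) = 1.
Proof. by rewrite /cz comp_mpolyXU -tnth_nth tnth_mktuple /zidx unlift_none. Qed.

Lemma dehomogenize_homog_poly d (f : A) :
  (homog_poly d f \mPo dehomogenize_vars) = f.
Proof.
rewrite [RHS]mpolyE /homog_poly raddf_sum; apply: eq_bigr => u _.
rewrite /= comp_mpolyZ rmorphM rmorphXn rmorph_prod /= dehomogenize_cz.
rewrite expr1n mul1r mpolyXE_id; congr (_ *: _); apply: eq_bigr => i _.
by rewrite rmorphXn /= dehomogenize_cx.
Qed.

(** The quotient q of f - h by the form has degree at most d - 1, and its homogenization in degree d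
    - 1 is the new quotient. *)
Lemma homog_poly_divides d (f h : A) (i j : 'I_l) (p : int) :
  (tdeg f <= d)%N -> (tdeg h <= d)%N ->
  divides ('X_i - 'X_j - p%:~R) (f - h) -> i != j ->
  divides (cx K i - cx K j - cz K l *~ p) (homog_poly d f - homog_poly d h).
Proof.
move=> fd hd [q E] ij.
have [q0|q0] := eqVneq q 0.
  move: E; rewrite q0 mul0r => /eqP; rewrite subr_eq0 => /eqP ->.
  by rewrite subrr; exact: divides0.
(* The form is not constant: its values at the origin and at the i-th unit vector differ by 1. *)
have al2 : (1 < msize ('X_i - 'X_j - p%:~R : A))%N.
  rewrite ltnNge; apply/negP => /msize1_polyC al1.
  have N (v : 'I_l -> K) : v i - v j - p%:~R = 
      ('X_i - 'X_j - p%:~R : A)@_0.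
    have := congr1 (meval v) al1.
    by rewrite mevalC !mevalB !mevalXU rmorph_int.
  have := N (fun k => (k == i)%:R); rewrite -(N (fun=> 0)).
  rewrite eqxx eq_sym (negPf ij) !subr0.
  by move/addIr/eqP; rewrite oner_eq0.
have fhd : (msize (f - h) <= d.+1)%N.
  apply: msizeD_leq; rewrite ?mmeasureN.
    by move: fd; rewrite /tdeg; case: (msize f).
  by move: hd; rewrite /tdeg; case: (msize h).
have [d0 qd] : (0 < d)%N /\ (tdeg q <= d.-1)%N.
  have al0 : 'X_i - 'X_j - p%:~R != 0 :> A.
    by rewrite -msize_poly_eq0 -lt0n ltnW.
  move: fhd; rewrite E msizeM_pred // /tdeg.
  have := q0; rewrite -msize_poly_eq0 -lt0n.
  have aux x y : (1 < y -> 0 < x -> (x + y).-1 <= d.+1 ->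
    0 < d /\ x.-1 <= d.-1)%N by lia.
  exact: aux al2.
exists (homog_poly d.-1 q).
apply/eqP; rewrite -tofrac_eq; apply/eqP.
have z0 : tofrac (cz K l) != 0 by rewrite tofrac_eq0 cz_neq0.
(* The morphism [psi] substitutes x_i / z for x_i; it carries the factorization of f - h to the
   fraction field. *)
pose psi : {rmorphism A -> {fraction R}} :=
  mmap (@tofrac R \o @mpolyC l.+1 K) (fun i => tofrac (cx K i) / tofrac (cz K l)).
have psiE e g : (tdeg g <= e)%N ->
    tofrac (homog_poly e g) = tofrac (cz K l) ^+ e * psi g.
  exact: homog_polyE.
have psiX k : psi 'X_k = tofrac (cx K k) / tofrac (cz K l).
  by rewrite /psi /= mmapX mmap1U.
rewrite rmorphB rmorphM /= !psiE // -mulrBr -rmorphB E rmorphM.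
rewrite !rmorphB rmorph_int !psiX /= rmorphMz /=.
rewrite -[in LHS](prednK d0) exprS.
have -> : tofrac (cz K l) *~ p = tofrac (cz K l) * p%:~R by rewrite mulrzr.
exact: dehomog_identity.
Qed.

End Homogenization.

(** * Linear independence at z = 1 *)

Section Independence.
Variables (K : numFieldType) (l m : nat).
Hypothesis m_gt0 : (0 < m)%N.
Local Notation A := {mpoly K[l]}.

Definition node (a : 'I_l) (s : nat) : A := 'X_a + s%:R.

Lemma nodes_uniq : uniq [seq node a s | a <- enum 'I_l, s <- iota 0 m].
Proof.
apply: allpairs_uniq; rewrite ?enum_uniq ?iota_uniq // => -[a s] [b t] _ _ /= E.
have st : s = t.
  have /eqP := congr1 (meval (fun=> 0 : K)) E.
  by rewrite !mevalD !mevalXU -!mpolyC_nat !mevalC !add0r eqr_nat => /eqP.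
by move: E; rewrite /node st => /addIr /mpolyX_inj ->.
Qed.

(* F - F(x_1) has the l m zeros x_a + s, but degree less than l m. *)
Lemma defsum_eq0 (f : {poly A}) : (size f <= (m * l).-1)%N ->
  (forall a s, (s < m.-1)%N -> f.[node a s] = 0) ->
  (forall a b, defsum 'X_a 'X_b f = 0) -> f = 0.
Proof.
move=> sf f0 ds.
have [l0|l0] := posnP l.
  by apply/eqP; rewrite -size_poly_eq0 -leqn0 (leq_trans sf) // l0 muln0.
have [F [FE sF _]] := antidifference_degree f.
pose P := F - F.['X_(Ordinal l0)]%:P.
have P0 : P = 0.
  have rP : all (root P) [seq node a s | a <- enum 'I_l, s <- iota 0 m].
    apply/allP => _ /allpairsP [[a s] /= [_ + ->]]; rewrite mem_iota add0n => /= sm.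
    apply/rootP; rewrite hornerD hornerN hornerC (horner_antidifferenceD _ _ FE).
    (* F(x_a + s) - F(x_a) is the sum of f over the points x_a + t with t < s <= m - 1, which are
       zeros of f. *)
    rewrite big1 => [|t _]; first by rewrite addr0 -(defsumE _ _ FE) ds.
    by rewrite f0 // (leq_trans (ltn_ord t)) // -ltnS prednK.
  apply: contraTeq isT => Pn0; have := max_poly_roots Pn0 rP nodes_uniq.
  rewrite size_allpairs size_enum_ord size_iota ltnNge mulnC => /negP [].
  have ml : (0 < m * l)%N by rewrite muln_gt0 m_gt0.
  apply: leq_trans (size_polyD _ _) _; rewrite geq_max size_polyN.
  rewrite (leq_trans (size_polyC_leq1 _)) // andbT (leq_trans sF) //.
  by rewrite -(prednK ml).
have FC : F = F.['X_(Ordinal l0)]%:P by apply/eqP; rewrite -subr_eq0; apply/eqP.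
by rewrite -FE FC comp_polyC subrr.
Qed.

(** The system is triangular: x_k - 1 is a zero of every g_j with j > k but not of g_k. With w_j = 0
    known for j < k, evaluation at x_k - 1 leaves w_k g_k(x_k - 1) = 0. *)
Lemma gk_combination_eq0 (w : 'I_l.-1 -> A) :
  \sum_k w k *: (gk K l m k - gk K l m k.+1) = 0 -> forall k, w k = 0.
Proof.
move=> S0 k.
have [q] := ubnP (val k); elim: q k => // q IHq k; rewrite ltnS => kq.
have kl : (k < l)%N by have := ltn_ord k; lia.
have := congr1 (horner^~ ('X_(Ordinal kl) - 1)) S0.
rewrite horner0 horner_sum (bigD1 k) //= big1 ?addr0 => [|j jk].
  rewrite hornerZ hornerD hornerN; have -> : (gk K l m k.+1).['X_(Ordinal kl) - 1] = 0.
    by apply: gk_root => //; exact: gk_roots_lt.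
  rewrite subr0 => /eqP; rewrite mulf_eq0 => /orP [/eqP //|].
  by have /negPf -> := gk_neq0 K (Ordinal kl) m_gt0.
rewrite hornerZ hornerD hornerN; have [jlt|jge] := ltnP j k.
  by rewrite (IHq j) ?mul0r //; exact: leq_trans jlt kq.
have kj : (k < j)%N by rewrite ltn_neqAle eq_sym jk.
rewrite !(gk_root m_gt0) ?subrr ?mulr0 //; apply: gk_roots_lt => //=.
Qed.

(** Here u plays the coefficient of [theta0]. Subtracting the relations at a and b removes it and
    leaves l times the sum from x_a to x_b of the combination of the g_k - g_(k+1). *)
Lemma tau_independent (w : 'I_l.-1 -> A) (u : A) :
  (forall a, \sum_k w k * (tau K l m k 0 a - tau K l m k.+1 0 a) + u = 0) ->
  forall k, w k = 0.
Proof.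
move=> E; apply: gk_combination_eq0.
apply: defsum_eq0 => [|a s sm|a b].
(* Both g_k and g_(k+1) are monic of degree m l - 1, so their difference has smaller degree. *)
- apply: leq_trans (size_sum _ _ _) _; apply/bigmax_leqP => k _.
  apply: leq_trans (size_scale_leq _ _) _.
  have [kl kl1] : (k < l)%N /\ (k.+1 < l)%N by have := ltn_ord k; lia.
  apply/leq_sizeP => j; rewrite leq_eqVlt => /orP [/eqP <-|jgt].
    have lc k' : (k' < l)%N -> (gk K l m k')`_(m * l).-1 = 1.
      move=> k'l; have /monicP := gk_monic K l k' m_gt0.
      by rewrite lead_coefE size_gk.
    by rewrite coefB !lc // subrr.
  by rewrite coefB !nth_default ?subrr // size_gk.
- rewrite horner_sum big1 // => k _.
  by rewrite hornerZ hornerD hornerN !gk_root ?subrr ?mulr0 // gk_roots_low.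
set f := \sum_k _; have l0 : (l%:R : K) != 0.
  by rewrite pnatr_eq0 -lt0n (leq_trans _ (ltn_ord a)).
suff /eqP : l%:R *: defsum 'X_a 'X_b f = 0.
  by rewrite scaler_eq0 (negPf l0) => /eqP.
have SE c := addr0_eq (etrans (addrC u _) (E c)).
rewrite /f defsum_comb scaler_sumr; apply: etrans (subrr (- u)).
rewrite [X in _ = X - _](SE a) [X in _ = _ - X](SE b) -sumrB.
apply: eq_bigr => k _; rewrite -mulrBr scaler_nat -mulrnAr; congr (_ * _).
by rewrite defsumB mulrnBl -!tau_sub !opprD addrACA.
Qed.

End Independence.

(** * The defining forms of the cone *)

Section Forms.
Variables (K : numFieldType) (l : nat).
Local Notation R := {mpoly K[l.+1]}.
Implicit Types (i j : 'I_l) (k : int).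

Definition shi_form i j k : R := cx K i - cx K j - cz K l *~ k.

(** Divisibility between forms is refuted by evaluation at such points, z being the last
    coordinate. *)
Definition cone_point (x : 'I_l -> K) (z : K) (v : 'I_l.+1) : K :=
  if unlift ord_max v is Some i then x i else z.

Lemma meval_cx x z i : (cx K i).@[cone_point x z] = x i.
Proof. by rewrite /cx mevalXU /cone_point /xidx liftK. Qed.

Lemma meval_cz x z : (cz K l).@[cone_point x z] = z.
Proof. by rewrite /cz mevalXU /cone_point /zidx unlift_none. Qed.

Lemma meval_shi_form x z i j k :
  (shi_form i j k).@[cone_point x z] = x i - x j - z *~ k.
Proof. by rewrite !mevalB raddfMz /= !meval_cx meval_cz. Qed.

Lemma divides_meval (a p : R) v : divides a p -> a.@[v] = 0 -> p.@[v] = 0.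
Proof. by move=> [q ->] a0; rewrite mevalM a0 mulr0. Qed.

Lemma cz_ndivides_shi_form i j k : (i < j)%N ->
  ~ divides (cz K l) (shi_form i j k).
Proof.
move=> ij /(divides_meval (v := cone_point (fun x => (x == i)%:R) 0)).
rewrite meval_cz meval_shi_form eqxx eq_sym -val_eqE (ltn_eqF ij) mul0rz !subr0.
by move=> /(_ erefl) /eqP; rewrite oner_eq0.
Qed.

Lemma shi_form_ndivides_cz i j k : (i < j)%N ->
  ~ divides (shi_form i j k) (cz K l).
Proof.
move=> ij /(divides_meval (v := cone_point (fun x => if x == i then k%:~R else 0) 1)).
rewrite meval_cz meval_shi_form eqxx eq_sym -val_eqE (ltn_eqF ij) subr0 subrr.
by move=> /(_ erefl) /eqP; rewrite oner_eq0.
Qed.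

(** The second form vanishes wherever the first does. Points with z = 0 determine the indices; the
    point with z = 1, x_i = k and zeros elsewhere determines k. *)
Lemma shi_form_divides i j k i' j' k' : (i < j)%N -> (i' < j')%N ->
  divides (shi_form i j k) (shi_form i' j' k') -> [/\ i = i', j = j' & k = k'].
Proof.
move=> ij ij' D.
have ne i1 j1 : (i1 < j1)%N -> (i1 == j1 :> 'I_l) = false.
  by move=> lt; rewrite -val_eqE (ltn_eqF lt).
have D0 (y : 'I_l -> K) : y i = y j -> y i' = y j'.
  move=> yE; have := divides_meval (v := cone_point y 0) D.
  rewrite !meval_shi_form !mul0rz !subr0 yE subrr => /(_ erefl) /eqP.
  by rewrite subr_eq0 => /eqP.
(* Otherwise the indicator function of i' would contradict [D0]. *)
have i'ij : (i' == i) || (i' == j).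
  apply/negP => /negP; rewrite negb_or => /andP [/negPf ni /negPf nj].
  have := D0 (fun x => (x == i')%:R); rewrite !(eq_sym _ i') ni nj eqxx (ne i') //.
  by move=> /(_ erefl) /eqP; rewrite oner_eq0.
have j'ij : (j' == i) || (j' == j).
  apply/negP => /negP; rewrite negb_or => /andP [/negPf ni /negPf nj].
  have := D0 (fun x => (x == j')%:R); rewrite !(eq_sym _ j') ni nj eqxx.
  rewrite eq_sym (ne i') //.
  by move=> /(_ erefl) /eqP; rewrite eq_sym oner_eq0.
have [ii jj] : i' = i /\ j' = j.
  case/orP: i'ij ij' => /eqP ->; case/orP: j'ij => /eqP -> //;
    by rewrite ?ltnn // ltnNge ltnW.
split=> //; move: D; rewrite ii jj => D.
have := divides_meval (v := cone_point (fun x => if x == i then k%:~R else 0) 1) D.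
rewrite !meval_shi_form eqxx eq_sym (ne i) // !subr0 subrr => /(_ erefl) /eqP.
by rewrite subr_eq0 eqr_int => /eqP.
Qed.

Lemma cShi_divides m (a b : R) :
  cShi m a -> cShi m b -> divides a b -> a = b.
Proof.
move=> [->|[i [j [k [ij _ ->]]]]] [->|[i' [j' [k' [ij' _ ->]]]]] //.
- by move/cz_ndivides_shi_form; case.
- by move/shi_form_ndivides_cz; case.
by move/shi_form_divides => [] // -> -> ->.
Qed.

Lemma xidx_eq i j : (xidx i == xidx j) = (i == j).
Proof. exact: (inj_eq (@lift_inj _ _)). Qed.

Lemma xidx_zidx i : (xidx i == zidx l) = false.
Proof. by rewrite eq_sym /xidx /zidx (negPf (neq_lift _ _)). Qed.

Lemma mderivXU n (u v : 'I_n) : mderiv u ('X_v : {mpoly K[n]}) = (v == u)%:R.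
Proof.
rewrite mderivX mnm1E; case: eqP => [->|_]; last by rewrite scale0r.
by rewrite -[X in (X - _)%MM]add0m addmK mpolyX0 scale1r.
Qed.

(** Each form is a variable minus a polynomial free of it: z - 0, or x_i - (x_j + k z). *)
Lemma cShi_prime m (a : R) : cShi m a ->
  [/\ prime_elt a, ~ divides a 1 & exists v, mderiv v a = 1].
Proof.
move=> [->|[i [j [k [ij _ ->]]]]].
  have E : (0 \mPo subst_var (zidx l) 0) = 0 :> R by rewrite comp_mpoly0.
  have -> : cz K l = 'X_(zidx l) - 0 by rewrite subr0.
  split; [exact: prime_elt_subst|exact: nondivides1_subst|].
  by exists (zidx l); rewrite subr0 mderivXU eqxx.
have -> : cx K i - cx K j - cz K l *~ k = 'X_(xidx i) - (cx K j + cz K l *~ k).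
  by rewrite opprD addrA.
set b := cx K j + _.
have E : (b \mPo subst_var (xidx i) b) = b.
  rewrite {1}/b rmorphD raddfMz /= /cx /cz !comp_mpolyXU -!tnth_nth.
  rewrite !tnth_mktuple xidx_eq [zidx l == _]eq_sym xidx_zidx.
  by rewrite -val_eqE (gtn_eqF ij).
split; [exact: prime_elt_subst|exact: nondivides1_subst|].
exists (xidx i); rewrite mderivB mderivXU eqxx mderivD raddfMz /=.
rewrite !mderivXU xidx_eq [zidx l == _]eq_sym xidx_zidx -val_eqE (gtn_eqF ij).
by rewrite mul0rz addr0 subr0.
Qed.

(** The third component q < 2m encodes k = q + 1 - m, which runs through 1 - m, ..., m. *)
Definition form_index m : seq ('I_l * 'I_l * 'I_m.*2) :=
  [seq t : 'I_l * 'I_l * 'I_m.*2 <- enum {: 'I_l * 'I_l * 'I_m.*2} | (t.1.1 < t.1.2)%N].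

Definition shi_forms m : seq R :=
  cz K l :: [seq shi_form t.1.1 t.1.2 (t.2%:Z + 1 - m%:Z) | t : 'I_l * 'I_l * 'I_m.*2 <- form_index m].

Lemma shi_formsP m a : a \in shi_forms m <-> cShi m a.
Proof.
rewrite inE; split=> [/orP [/eqP ->|/mapP [[[i j] q]]]|].
- by left.
- rewrite mem_filter => /= /andP [ij _] ->; right.
  exists i, j, (q%:Z + 1 - m%:Z); split=> //.
  by have := ltn_ord q; lia.
case=> [->|[i [j [k [ij km ->]]]]]; first by rewrite eqxx.
apply/orP; right; apply/mapP.
have qm : (absz (k - 1 + m%:Z)%R < m.*2)%N by lia.
exists (i, j, Ordinal qm); first by rewrite mem_filter /= ij mem_enum.
rewrite /=; congr (_ - _ *~ _); lia.
Qed.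

Lemma shi_forms_uniq m : uniq (shi_forms m).
Proof.
have self (a : R) : divides a a by exists 1; rewrite mul1r.
rewrite /=; apply/andP; split.
  apply/mapP => -[[[i j] q]]; rewrite mem_filter /= => /andP [ij _] E.
  by apply: (cz_ndivides_shi_form (k := q%:Z + 1 - m%:Z) ij); rewrite -E.
rewrite map_inj_in_uniq; first exact/filter_uniq/enum_uniq.
move=> [[i j] q] [[i' j'] q']; rewrite !mem_filter /= => /andP [ij _] /andP [ij' _] E.
have [|-> -> qq] := shi_form_divides (k := q%:Z + 1 - m%:Z)
  (k' := q'%:Z + 1 - m%:Z) ij ij'; first by rewrite E.
by congr (_, _, _); apply: val_inj => /=; lia.
Qed.

(** There are l (l - 1) / 2 pairs i < j, with 2m values of k each, and the form z. *)
Lemma size_shi_forms m : size (shi_forms m) = (m * l * l.-1).+1.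
Proof.
rewrite /= size_map; congr S.
rewrite size_filter -sumn_count sumnE big_map big_enum /=.
rewrite -(pair_bigA _ (fun (t : 'I_l * 'I_l) (_ : 'I_m.*2) => nat_of_bool (t.1 < t.2)%N)) /=.
rewrite -(pair_bigA _ (fun i j : 'I_l => \sum_(q < m.*2) nat_of_bool (i < j))%N) /=.
have lt_sum (j : 'I_l) : (\sum_(i < l) nat_of_bool (i < j) = j)%N.
  rewrite -(big_mkord xpredT (fun i : nat => nat_of_bool (i < j)%N)).
  rewrite (big_cat_nat (leq0n j) (ltnW (ltn_ord j))) /=.
  rewrite [X in (_ + X)%N]big_nat [X in (_ + X)%N]big1 ?addn0 => [|i /andP [ji _]].
    rewrite big_nat (eq_bigr (fun=> 1%N)) => [|i /andP [_ ->] //].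
    by rewrite -big_nat sum_nat_const_nat subn0 muln1.
  by rewrite ltnNge ji.
under eq_bigr do under eq_bigr do rewrite sum_nat_const card_ord.
rewrite exchange_big /=.
under eq_bigr do rewrite -big_distrr /= lt_sum.
rewrite -big_distrr /= -(big_mkord xpredT id) /= bin2_sum bin2.
rewrite -muln2 -mulnA [(2 * _)%N]mulnC muln2 -mulnA.
case: l => [|n]; first by rewrite !muln0.
(* The product n (n + 1) is even, so doubling its half gives it back. *)
by rewrite /= halfK oddM /= andNb subn0.
Qed.

Lemma msize_cShi m (a : R) : cShi m a -> (1 < msize a)%N.
Proof.
move=> /cShi_prime [_ n1 [v av]]; rewrite ltnNge; apply/negP => /msize1_polyC aE.
by move/eqP: av; rewrite aE mderivC eq_sym oner_eq0.
Qed.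

End Forms.

(** * The basis *)

Section ConeFields.
Variables (K : numFieldType) (l : nat).
Local Notation R := {mpoly K[l.+1]}.

Lemma der_apply_shi_form (d : Der K l.+1) i j k :
  der_apply d (shi_form K i j k) =
  d 0 (xidx i) - d 0 (xidx j) - d 0 (zidx l) *~ k.
Proof.
have dX v : \sum_u d 0 u * mderiv u ('X_v : R) = d 0 v.
  rewrite (bigD1 v) //= big1 ?addr0 => [|u uv].
    by rewrite mderivXU eqxx mulr1.
  by rewrite mderivXU eq_sym (negPf uv) mulr0.
rewrite -!dX mulrz_suml -!sumrB; apply: eq_bigr => u _.
by rewrite !mderivB raddfMz /= !mulrBr mulrzAr.
Qed.

Lemma der_apply_cz (d : Der K l.+1) : der_apply d (cz K l) = d 0 (zidx l).
Proof.
rewrite /der_apply (bigD1 (zidx l)) //= big1 ?addr0 => [|u uv].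
  by rewrite mderivXU eqxx mulr1.
by rewrite mderivXU eq_sym (negPf uv) mulr0.
Qed.

Lemma sum_partial_x (f : 'I_l -> R) i :
  (\sum_(j < l) f j *: partial K (xidx j)) 0 (xidx i) = f i.
Proof.
rewrite summxE (bigD1 i) //= [X in _ + X]big1 ?addr0 => [|j ji].
  by rewrite /partial !mxE !eqxx mulr1.
by rewrite /partial !mxE xidx_eq eq_sym (negPf ji) andbF mulr0.
Qed.

Lemma sum_partial_z (f : 'I_l -> R) :
  (\sum_(j < l) f j *: partial K (xidx j)) 0 (zidx l) = 0.
Proof.
rewrite summxE big1 // => j _.
by rewrite /partial !mxE [zidx l == _]eq_sym xidx_zidx andbF mulr0.
Qed.

Definition max_tdeg (d : Der K l) := (\max_(i < l) tdeg (d 0%R i))%N.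

Lemma tdeg_max (d : Der K l) i : (tdeg (d 0%R i) <= max_tdeg d)%N.
Proof. by rewrite /max_tdeg (leq_bigmax (F := fun i => tdeg (d 0%R i))). Qed.

Lemma homogenize_x (d : Der K l) i :
  homogenize d 0 (xidx i) = homog_poly (max_tdeg d) (d 0 i).
Proof. exact: sum_partial_x. Qed.

Lemma homogenize_z (d : Der K l) : homogenize d 0 (zidx l) = 0.
Proof. exact: sum_partial_z. Qed.

Lemma homogenizeB_z (d e : Der K l) :
  (homogenize d - homogenize e) 0 (zidx l) = 0.
Proof. by rewrite mxE [X in _ + X]mxE !homogenize_z subrr. Qed.

Lemma dehomogenizeB_x (d e : Der K l) i :
  ((homogenize d - homogenize e) 0 (xidx i) \mPo dehomogenize_vars K l) =
  d 0 i - e 0 i.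
Proof.
by rewrite mxE [X in _ + X]mxE !homogenize_x comp_mpolyB !dehomogenize_homog_poly.
Qed.

Lemma theta0_x i : theta0 K l 0 (xidx i) = 1.
Proof.
rewrite /theta0; under eq_bigr do rewrite -[partial _ _]scale1r.
exact: sum_partial_x.
Qed.

Lemma theta0_z : theta0 K l 0 (zidx l) = 0.
Proof.
rewrite /theta0; under eq_bigr do rewrite -[partial _ _]scale1r.
exact: sum_partial_z.
Qed.

Lemma thetaE_x i : thetaE K l 0 (xidx i) = cx K i.
Proof.
by rewrite /thetaE mxE sum_partial_x /partial !mxE xidx_zidx andbF mulr0 add0r.
Qed.

Lemma thetaE_z : thetaE K l 0 (zidx l) = cz K l.
Proof. by rewrite /thetaE mxE sum_partial_z /partial !mxE !eqxx mulr1 addr0. Qed.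

Lemma coordP (P : 'I_l.+1 -> Prop) :
  P (zidx l) -> (forall i, P (xidx i)) -> forall v, P v.
Proof. by move=> Pz Px v; case: (unliftP ord_max v) => [i ->|->]; first exact: Px. Qed.

Variable m : nat.
Hypothesis m_gt0 : (0 < m)%N.

(** The z-component is 0 and all x-components are homogenized in one degree, so the divisibility of
    tau_k(x_i - x_j) by x_i - x_j - p carries over to the cone. *)
Lemma tau_logDer k : logDer (@cShi K l m) (homogenize (tau K l m k)).
Proof.
move=> _ [->|[i [j [p [ij pm ->]]]]].
  by rewrite der_apply_cz homogenize_z; exact: divides0.
rewrite der_apply_shi_form homogenize_z mul0rz subr0 !homogenize_x.
apply: homog_poly_divides; rewrite ?tdeg_max //.
  rewrite tau_sub -mulr_natr; apply/dividesMr; exact: defsum_gk_divides.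
by rewrite -val_eqE (ltn_eqF ij).
Qed.

Lemma theta0_logDer : logDer (@cShi K l m) (theta0 K l).
Proof.
move=> _ [->|[i [j [p [ij pm ->]]]]].
  by rewrite der_apply_cz theta0_z; exact: divides0.
by rewrite der_apply_shi_form theta0_z !theta0_x mul0rz subrr subr0; exact: divides0.
Qed.

Lemma thetaE_logDer : logDer (@cShi K l m) (thetaE K l).
Proof.
move=> _ [->|[i [j [p [ij pm ->]]]]]; exists 1; rewrite mul1r.
  by rewrite der_apply_cz thetaE_z.
by rewrite der_apply_shi_form thetaE_z !thetaE_x.
Qed.

Lemma logDerB (arr : R -> Prop) (d e : Der K l.+1) :
  logDer arr d -> logDer arr e -> logDer arr (d - e).
Proof.
move=> dD eD a aa; rewrite -scaleN1r der_applyD der_applyZ.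
by apply: dividesD; [exact: dD|apply/dividesMl/eD].
Qed.

Lemma msize_homogenize_tau k v : (k < l)%N ->
  (msize (homogenize (tau K l m k) 0%R v) <= (m * l).+1)%N.
Proof.
move=> kl; elim/coordP: v => [|i]; first by rewrite homogenize_z mmeasure0.
rewrite homogenize_x; apply: leq_trans (msize_homog_poly (tdeg_max _ _)) _.
rewrite ltnS; apply/bigmax_leqP => j _; rewrite /tdeg.
by have := msize_tau K j m_gt0 kl; case: (msize _).
Qed.

End ConeFields.

(** * Entries of a list extended by two elements *)

Section Lists.
Variables (V : nmodType) (f : nat -> V) (a b : V) (n : nat).
Local Notation s := ([seq f k | k <- iota 0 n] ++ [:: a; b]).

Lemma nth_iota_cat2 i : (i < n)%N -> s`_i = f i.
Proof.
by move=> i_n; rewrite nth_cat size_map size_iota i_n (nth_map 0%N) ?size_iota // nth_iota.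
Qed.

Lemma nth_iota_cat2n : s`_n = a.
Proof. by rewrite nth_cat size_map size_iota ltnn subnn. Qed.

Lemma nth_iota_cat2Sn : s`_n.+1 = b.
Proof. by rewrite nth_cat size_map size_iota ltnNge leqnSn subSnn. Qed.

End Lists.

(** * The determinant of the fields *)

Section MainTheorem.
Variables (K : numFieldType) (n m : nat).
Hypothesis m_gt0 : (0 < m)%N.
Local Notation l := n.+1.
Local Notation fields := (shi_fields K l m).

Lemma size_fields : size fields = l.+1.
Proof.
rewrite /shi_fields; move: (theta0 K l) (thetaE K l) => a b.
rewrite size_cat size_map size_iota; exact: addn2.
Qed.

Lemma fields_tau i : (i < n)%N ->
  fields`_i = homogenize (tau K l m i) - homogenize (tau K l m i.+1).
Proof. exact: nth_iota_cat2. Qed.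

Lemma fields_theta0 : fields`_n = theta0 K l.
Proof. exact: nth_iota_cat2n. Qed.

Lemma fields_thetaE : fields`_n.+1 = thetaE K l.
Proof. exact: nth_iota_cat2Sn. Qed.

Lemma fields_logDer i : (i < l.+1)%N -> logDer (@cShi K l m) fields`_i.
Proof.
rewrite !ltnS leq_eqVlt => /orP [/eqP ->|].
  by rewrite fields_thetaE; exact: thetaE_logDer.
rewrite ltnS leq_eqVlt => /orP [/eqP ->|i_n].
  by rewrite fields_theta0; exact: theta0_logDer.
by rewrite fields_tau //; apply: logDerB; exact: tau_logDer.
Qed.

Definition saito_mx : 'M[{mpoly K[l.+1]}]_l.+1 := \matrix_(i < l.+1) fields`_i.

Lemma saito_mxE i j : saito_mx i j = fields`_i 0 j.
Proof.
have /rowP/(_ j) <- : row i saito_mx = fields`_i by exact: rowK.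
exact/esym/mxE.
Qed.

(** These row degrees add up to m l (l - 1) + 1, the number of hyperplanes. *)
Definition field_degree (i : nat) : nat :=
  if (i < n)%N then m * l else if i == n then 0 else 1.

Lemma msize_det_saito_mx : (msize (\det saito_mx) <= (size (shi_forms K l m)).+1)%N.
Proof.
have -> : size (shi_forms K l m) = (\sum_(i < l.+1) field_degree i)%N.
  rewrite size_shi_forms !big_ord_recr /=.
  rewrite (eq_bigr (fun=> m * l)%N); last first.
    by move=> i _; rewrite /field_degree ltn_ord.
  rewrite sum_nat_const card_ord /field_degree ltnn eqxx ltnNge leqnSn gtn_eqF //=.
  by rewrite addn0 addn1 mulnC.
apply: msize_det_leq => i j; rewrite saito_mxE.
have := ltn_ord i; rewrite !ltnS leq_eqVlt /field_degree => /orP [/eqP ->|].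
  rewrite fields_thetaE ltnNge leqnSn gtn_eqF //=.
  by elim/coordP: j => [|j]; rewrite ?thetaE_z ?thetaE_x ?msize_cz ?msize_cx.
rewrite ltnS leq_eqVlt => /orP [/eqP ->|i_n].
  rewrite fields_theta0 ltnn eqxx.
  by elim/coordP: j => [|j]; rewrite ?theta0_z ?theta0_x ?mmeasure0 ?msize1.
rewrite (fields_tau i_n) i_n mxE [X in _ + X]mxE; apply: msizeD_leq.
  by apply: msize_homogenize_tau => //; exact: ltnW.
by rewrite mmeasureN; apply: msize_homogenize_tau.
Qed.

(** Otherwise some nonzero row vector v annihilates the matrix at z = 1. The z-column kills its
    [thetaE] entry, [tau_independent] those of the differences, and any x-column then the [theta0]
    entry. *)
Lemma det_saito_mx_neq0 : \det saito_mx != 0.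
Proof.
pose phi : {rmorphism {mpoly K[l.+1]} -> {mpoly K[l]}} :=
  comp_mpoly (dehomogenize_vars K l).
apply/negP => /eqP /(congr1 phi) /eqP; rewrite rmorph0 -det_map_mx => /det0P.
move=> [v v0 /rowP vM]; case/negP: v0; apply/eqP/rowP.
pose w (k : 'I_n) := v 0 (widen_ord (leqnSn _) (widen_ord (leqnSn _) k)).
have vE j : \sum_(k < n) w k * phi (fields`_k 0 j) +
    v 0 (widen_ord (leqnSn _) ord_max) * phi (fields`_n 0 j) +
    v 0 ord_max * phi (fields`_n.+1 0 j) = 0.
  transitivity ((v *m map_mx phi saito_mx) 0 j); last by rewrite vM mxE.
  rewrite [RHS]mxE.
  rewrite [RHS](eq_bigr (fun k : 'I__ => v 0 k * phi (fields`_k 0 j))) => [|k _].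
    by rewrite [RHS]big_ord_recr [X in _ = X + _]big_ord_recr.
  by rewrite [in LHS]mxE saito_mxE.
rewrite fields_theta0 fields_thetaE in vE.
(* Only [thetaE] has a nonzero z-component, equal to 1 at z = 1. *)
have vmax : v 0 ord_max = 0.
  have := vE (zidx l); rewrite theta0_z rmorph0 mulr0 addr0 thetaE_z.
  rewrite [phi _]dehomogenize_cz mulr1 big1 ?add0r // => k _.
  by rewrite (fields_tau (ltn_ord k)) homogenizeB_z rmorph0 mulr0.
have vx a : \sum_(k < n) w k * (tau K l m k 0 a - tau K l m k.+1 0 a) +
    v 0 (widen_ord (leqnSn _) ord_max) = 0.
  rewrite -[RHS](vE (xidx a)) vmax mul0r addr0 theta0_x rmorph1 mulr1.
  congr (_ + _); apply: eq_bigr => k _; congr (_ * _).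
  by rewrite (fields_tau (ltn_ord k)); exact/esym/dehomogenizeB_x.
have w0 := tau_independent m_gt0 vx.
have vu : v 0 (widen_ord (leqnSn _) ord_max) = 0.
  have := vx ord0; rewrite big1 ?add0r // => k _.
  by rewrite w0 mul0r.
move=> i; rewrite mxE.
case: (unliftP ord_max i) => [j ->|-> //].
case: (unliftP ord_max j) => [k ->|->].
  rewrite -[RHS](w0 k) /w; congr (v 0 _); apply: val_inj.
  exact: etrans (lift_max _) (lift_max _).
rewrite -[RHS]vu; congr (v 0 _); apply: val_inj.
exact: lift_max.
Qed.

(** The product of the forms divides the determinant, whose degree is at most the number of forms;
    so the quotient is constant, and it is nonzero with the determinant. *)
Lemma det_saito_mx :
  exists2 u : K, u != 0 & \det saito_mx = u *: \prod_(a <- shi_forms K l m) a.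
Proof.
have [q E] : divides (\prod_(a <- shi_forms K l m) a) (\det saito_mx).
  apply: prod_divides; first exact: shi_forms_uniq.
  - by move=> a /shi_formsP /cShi_prime [].
  - by move=> a b /shi_formsP aa /shi_formsP; exact: cShi_divides aa.
  move=> a /shi_formsP aa; have [_ _ [v av]] := cShi_prime aa.
  apply: (divides_det av) => i; rewrite rowK.
  exact: fields_logDer (ltn_ord i) _ aa.
have det0 := det_saito_mx_neq0.
have q0 : q != 0 by apply: contra_neq det0 => q0; rewrite E q0 mul0r.
have Q0 : \prod_(a <- shi_forms K l m) a != 0.
  by apply: contra_neq det0 => Q0; rewrite E Q0 mulr0.
have sQ : (size (shi_forms K l m) < msize (\prod_(a <- shi_forms K l m) a))%N.
  by apply: msize_prod_geq => a /shi_formsP; exact: msize_cShi.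
have := msize_det_saito_mx; rewrite E msizeM_pred //.
have aux x y s : (s < y -> (x + y).-1 <= s.+1 -> x <= 1)%N by lia.
move=> /(aux _ _ _ sQ) /msize1_polyC qE.
exists q@_0; last by rewrite qE mul_mpolyC mcoeffC eqxx mulr1.
by apply: contra_neq q0 => q00; rewrite qE q00.
Qed.

Lemma shi_fields_basis : is_basis (logDer (@cShi K l m)) fields.
Proof.
have [u u0 detE] := det_saito_mx.
apply: (saito (forms := shi_forms K l m) (u := u)).
- exact: size_fields.
- exact: shi_forms_uniq.
- exact: shi_formsP.
- by move=> a; exact: cShi_prime.
- by move=> a b aa; exact: cShi_divides aa.
- exact: fields_logDer.
- exact: u0.
- exact: detE.
Qed.

End MainTheorem.

Theorem theorem4p2 (R : realType) (l m : nat) (hl : (2 <= l)%N)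
    (hm : (1 <= m)%N) :
  is_basis (logDer (@cShi R[i] l m)) (shi_fields R[i] l m).
Proof. by case: l hl => // n _; exact: shi_fields_basis. Qed.
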